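(* Let $n\ge 2$, let $V = (V_1,\ldots,V_n)$ be a $\mathcal{U}_n$-twisted isometry on a Hilbert space $\mathcal{H}$, and for $A \subseteq I_n=\{1,\ldots,n\}$ set $$\mathcal{H}_A := \bigoplus_{k \in \mathbb{Z}_+^{|A|}} V_A^k \Big(\bigcap_{l \in \mathbb{Z}_+^{n - |A|}} V_{I_n \setminus A}^l \mathcal{W}_A\Big).$$ For each $A\subseteq I_n$ let $\mathcal{S}_A$ be a closed subspace of $\mathcal{H}$ that reduces $V_1,\ldots,V_n$. Suppose that $\mathcal{H} = \bigoplus_{A\subseteq I_n} \mathcal{S}_A$ (orthogonal direct sum) and that, for each $A\subseteq I_n$, $V_i|_{\mathcal{S}_A}$ is a shift for every $i \in A$ and $V_j|_{\mathcal{S}_A}$ is a unitary for every $j \in A^c$. Then $\mathcal{S}_A = \mathcal{H}_A$ for all $A \subseteq I_n$.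
   Context: All Hilbert spaces are complex and separable. An isometry $T$ on a Hilbert space is a shift if $T^{*m} \to 0$ in the strong operator topology. A closed subspace reduces an operator $T$ if it is invariant under $T$ and $T^*$. $\mathcal{U}_n$-twisted isometry: let $\{U_{ij}\}_{1 \leq i<j\leq n}$ be commuting unitaries on $\mathcal{H}$ and put $U_{ji} := U_{ij}^*$ for $i<j$. An $n$-tuple of isometries $(V_1,\ldots,V_n)$ on $\mathcal{H}$ is a $\mathcal{U}_n$-twisted isometry with respect to $\{U_{ij}\}_{i<j}$ if $V_i^*V_j=U_{ij}^*V_jV_i^*$ and $V_kU_{ij}=U_{ij}V_k$ for all $i,j,k\in\{1,\ldots,n\}$ with $i \neq j$. When the unitaries are not mentioned, they are assumed to exist. Notation: for $A = \{i_1 < \cdots < i_m\} \subseteq I_n$ and $k \in \mathbb{Z}_+^m$ (where $\mathbb{Z}_+=\{0,1,2,\ldots\}$), $V_A^k = V_{i_1}^{k_1}\cdots V_{i_m}^{k_m}$; $\mathcal{W}_A = \bigcap_{i\in A}\ker V_i^*$ for $A \neq \emptyset$, $\mathcal{W}_\emptyset = \mathcal{H}$; $A^c = I_n\setminus A$. For the empty index set there is exactly one term and $V_\emptyset^k = I$; thus $\mathcal{H}_\emptyset = \bigcap_{l \in \mathbb{Z}_+^n} V^l\mathcal{H}$ and $\mathcal{H}_{I_n} = \bigoplus_{k\in\mathbb{Z}_+^n} V^k \mathcal{W}_{I_n}$. *)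

(* Defs.v *)
From mathcomp Require Export all_boot all_order all_algebra.
From mathcomp Require Export complex.
From mathcomp Require Export all_classical all_reals all_analysis.
Export numFieldNormedType.Exports.
Export Order.TTheory GRing.Theory Num.Theory Num.Def.

Set Implicit Arguments.
Unset Strict Implicit.
Unset Printing Implicit Defensive.

Global Open Scope classical_set_scope.
Global Open Scope ring_scope.

Definition separable (T : topologicalType) : Prop :=
  exists2 D : set T, countable D & dense D.

Section Hilbert.
Context {R : realType} {H : completeNormedModType R[i]}.
Variable dot : {dot H for @conjC R[i]}.

(* The complete norm of H is the one of the inner product, so that (H, dot) is
   a complex Hilbert space; dot is linear in its first argument. *)
Definition hilbert_norm : Prop := forall x : H, dot x x = `|x| ^+ 2.

Definition closed_subspace (M : set H) : Prop :=
  closed M /\ submod_closed [in M].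

Section OperatorOnSubspace.
(* For a closed subspace M, itself a Hilbert space, and T mapping M to M,
   the notions below are those of the operator T|_M on M. The case of operators
   on the whole space is M := setT. *)
Variables (M : set H) (T : H -> H).

(* The vector z such that <T x, y> = <x, z> for all x in M: it is unique, and by
   Riesz it exists if T|_M is a bounded linear operator on M and y is in M; the
   default value 0 is then irrelevant. *)
Definition adjoint_on (y : H) : H :=
  xget 0 [set z | M z /\ forall x, M x -> dot (T x) y = dot x z].

Definition isometry_on : Prop := forall x, M x -> `|T x| = `|x|.

Definition unitary_on : Prop :=
  forall x, M x -> adjoint_on (T x) = x /\ T (adjoint_on x) = x.

Definition shift_on : Prop :=
  isometry_on /\
  forall x, M x -> (fun m : nat => iter m adjoint_on x) @ \oo --> (0 : H).

End OperatorOnSubspace.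

Definition adjoint (T : H -> H) : H -> H := adjoint_on setT T.

Definition reduces (M : set H) (T : H -> H) : Prop :=
  T @` M `<=` M /\ adjoint T @` M `<=` M.

Definition orthogonal_family (I : eqType) (E : I -> set H) : Prop :=
  forall i j, i != j -> forall x y, E i x -> E j y -> dot x y = 0.

(* The Hilbert space direct sum of an orthogonal family of closed subspaces:
   the closure of the set of finite sums. *)
Definition hsum (I : eqType) (E : I -> set H) : set H :=
  closure [set x | exists (s : seq I) (f : I -> H),
    [/\ uniq s, forall i, i \in s -> E i (f i) & x = \sum_(i <- s) f i]].

Section TwistedIsometry.
Variables (n : nat) (V : 'I_n -> {linear H -> H}).

Definition twisted_isometry_wrt (U : 'I_n -> 'I_n -> {linear H -> H}) : Prop :=
  [/\ forall i j : 'I_n, (i < j)%N ->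
        unitary_on setT (U i j) /\ U j i =1 adjoint (U i j),
      forall i j k l : 'I_n, (i < j)%N -> (k < l)%N ->
        U i j \o U k l =1 U k l \o U i j,
      forall i, isometry_on setT (V i),
      forall i j, i != j ->
        adjoint (V i) \o V j =1 adjoint (U i j) \o V j \o adjoint (V i) &
      forall i j k, i != j -> V k \o U i j =1 U i j \o V k].

Definition twisted_isometry : Prop := exists U, twisted_isometry_wrt U.

(* V_A^k = V_{i_1}^{k_1} ... V_{i_m}^{k_m}; enum_val lists the elements of A in
   increasing order, and the big operator composes them in this order. *)
Definition Vpow (A : {set 'I_n}) (k : #|A|.-tuple nat) : H -> H :=
  \big[comp/id]_(j < #|A|) iter (tnth k j) (V (enum_val j)).

Definition wandering (A : {set 'I_n}) : set H :=
  [set x | forall i, i \in A -> adjoint (V i) x = 0].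

Definition summand (A : {set 'I_n}) (k : #|A|.-tuple nat) : set H :=
  Vpow k @` \bigcap_(l : #|~: A|.-tuple nat) (Vpow l @` wandering A).

Definition calH (A : {set 'I_n}) : set H := hsum (@summand A).

End TwistedIsometry.

End Hilbert.

(* Main.v *)
Require Import Defs.
From mathcomp Require Import ring.

(** Write [Vs i] for the adjoint of [V i] and [W] for the set of vectors killed
    by [Vs i] for all [i \in A]. The summands of the space attached to [A] are
    the images of [core A], the intersection of the [V^l W] over the monomials
    in the complement of [A], under the monomials in [A]. The point is that
    [core A] is exactly the intersection of [S A] and [W].

    A vector of [core A] is orthogonal to [S B] for every [B] other than [A]
    ([core_orth]): if [i] is in [A] but not in [B], then [V i] is onto on [S B]
    while [Vs i] kills the vector; if [j] is in [B] but not in [A], then the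
    vector is in the range of all powers of [V j], while the powers of [Vs j]
    tend to 0 on [S B]. As [H] is the sum of the [S B], the vector is in [S A]
    ([hsum_orth]). Conversely, the operators outside [A] are invertible on
    [S A], with inverses that preserve [W] ([sub_core]).

    It remains to decompose [S A] with respect to the shifts [V i], [i \in A].
    Iterating the Wold decomposition over [A] shows that [S A] is the closed
    span of the monomials in [A] applied to the intersection of [S A] and [W]
    ([wold_word]); and those images are pairwise orthogonal ([orth_word]).

    The twisted relations enter through one consequence: the norm of
    [Vs i (V j x)] is that of [Vs i x] for distinct [i] and [j]
    ([twisted_norm]). It implies that [V j] and [Vs j] preserve the kernel of
    [Vs i]. For [V j] this is immediate. For [Vs j] it is dual to the fact that
    [V j] preserves the range of [V i], and [y] is in this range when [Vs i y]
    has the norm of [y].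

    The adjoint is defined by a choice with a default value, so its existence
    has to be proved: [isometry_adjoint_ex] does it by least squares. *)

Set Implicit Arguments.
Unset Strict Implicit.
Unset Printing Implicit Defensive.

(** * Inner products *)

Section InnerProduct.
Context {R : realType} {H : completeNormedModType R[i]}.
Variable dot : {dot H for @conjC R[i]}.
Hypothesis normH : hilbert_norm dot.

Lemma dotC x y : dot x y = (dot y x)^*.
Proof. by rewrite hermC expr0 mul1r. Qed.

Lemma dot0C x y : dot x y = 0 -> dot y x = 0.
Proof. by move=> xy; rewrite dotC xy rmorph0. Qed.

Lemma dotZl a x y : dot (a *: x) y = a * dot x y.
Proof. exact: linearZl_LR. Qed.

Lemma dotZr a x y : dot x (a *: y) = a^* * dot x y.
Proof. exact: linearZr_LR. Qed.

Lemma dot_inj y z : (forall x, dot x y = dot x z) -> y = z.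
Proof.
move=> yz; apply/eqP; rewrite -subr_eq0 -normr_eq0 -sqrf_eq0 -normH.
by rewrite linearBr/= yz subrr.
Qed.

Lemma pythagoras x y : dot x y = 0 -> `|x + y| ^+ 2 = `|x| ^+ 2 + `|y| ^+ 2.
Proof. by move=> xy; rewrite -!normH hnormDd. Qed.

Lemma sqr_normB x y :
  `|x - y| ^+ 2 = `|x| ^+ 2 + `|y| ^+ 2 - (dot x y + (dot x y)^*).
Proof. by rewrite -!normH dnormB. Qed.

Lemma parallelogram (x y : H) :
  `|x - y| ^+ 2 = `|x| ^+ 2 *+ 2 + `|y| ^+ 2 *+ 2 - `|x + y| ^+ 2.
Proof.
rewrite sqr_normB -[X in x + X](opprK y) sqr_normB normrN linearNr/= rmorphN.
set u := `|x| ^+ 2; set v := `|y| ^+ 2; set c := dot x y.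
by rewrite !mulr2n; ring.
Qed.

(** If the inner product [c] were nonzero, moving [x] by the small multiple
    [t * c] of [z] would shorten it; [t] below is small enough for the
    quadratic term to be dominated by the linear one. *)
Lemma orth_of_le_dist x z :
  (forall a, `|x| ^+ 2 <= `|x - a *: z| ^+ 2) -> dot x z = 0.
Proof.
move=> min_x; apply/eqP/negPn/negP => c0; pose c := dot x z.
pose t : R[i] := (`|z| ^+ 2 + 1)^-1.
have t1 : 0 < `|z| ^+ 2 + 1 :> R[i] by rewrite ltr_wpDl// exprn_ge0.
have t0 : 0 < t by rewrite invr_gt0.
have tr : t^* = t by apply: conj_Creal; rewrite gtr0_real.
have := min_x (t * c); rewrite sqr_normB dotZr rmorphM -/c.
rewrite !rmorphM /= !tr conjCK normrZ normrM exprMn (gtr0_norm t0) exprMn.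
have -> : t * c^* * c + t * c * c^* = t * `|c| ^+ 2 *+ 2.
  by rewrite normCK mulr2n; ring.
have tz : t * `|z| ^+ 2 < 1.
  by rewrite /t mulrC ltr_pdivrMr// mul1r ltrDl.
have cc : 0 < `|c| ^+ 2 by rewrite exprn_gt0// normr_gt0.
rewrite -addrA lerDl subr_ge0.
have -> : t ^+ 2 * `|c| ^+ 2 * `|z| ^+ 2 = t * `|c| ^+ 2 * (t * `|z| ^+ 2).
  by ring.
rewrite -mulr_natr ler_pM2l ?(mulr_gt0 t0 cc)// => /le_lt_trans/(_ tz).
by rewrite ltrn1.
Qed.

(** Pythagoras for the projection [a *: y] of [x] on the line of [y]. *)
Lemma cauchy_schwarz x y : `|dot x y| <= `|x| * `|y|.
Proof.
have [->|y0] := eqVneq y 0; first by rewrite linear0r normr0 mulr_ge0.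
rewrite -ler_sqr ?nnegrE ?mulr_ge0// exprMn.
have yy : 0 < `|y| ^+ 2 by rewrite exprn_gt0// normr_gt0.
pose a := dot x y / `|y| ^+ 2.
have ao : dot (x - a *: y) (a *: y) = 0.
  by rewrite dotZr linearBl/= dotZl normH divfK ?gt_eqF// subrr mulr0.
have aE : `|a *: y| ^+ 2 * `|y| ^+ 2 = `|dot x y| ^+ 2.
  rewrite normrZ exprMn /a normrM normfV (ger0_norm (exprn_ge0 _ _))//.
  by rewrite -mulrA -expr2 -exprMn divfK// gt_eqF.
have := pythagoras ao; rewrite subrK => ->.
by rewrite mulrDl aE lerDr mulr_ge0// exprn_ge0.
Qed.

End InnerProduct.

(** * Isometries have adjoints *)

(** The order of the complex numbers is only partial, so infima of nonnegative
    functions have to be transported from the reals. *)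
Lemma complex_inf {R : realType} (T : Type) (f : T -> R[i]) (x0 : T) :
  (forall x, 0 <= f x) ->
  exists d, (forall x, d <= f x) /\ forall e, 0 < e -> exists x, f x < d + e.
Proof.
move=> f0.
have fE x : f x = (complex.Re (f x))%:C%C by rewrite RRe_real// ger0_real.
pose E : set R := range (fun x => complex.Re (f x)).
have lbE : has_lbound E.
  by exists 0 => _ [x _ <-]; rewrite /= -ler0c -fE.
have infE : has_inf E by split=> //; exists (complex.Re (f x0)), x0.
exists (inf E)%:C%C; split=> [x|e e0].
  by rewrite fE lecR; apply: ge_inf => //; exists x.
have eE : e = (complex.Re e)%:C%C by rewrite RRe_real// gtr0_real.
have re0 : 0 < complex.Re e by rewrite -ltcR -eE.
have [_ [x _ <-] /= lt_x] := inf_adherent re0 infE.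
by exists x; rewrite fE eE -rmorphD ltcR.
Qed.

Lemma closure_normP {K : numFieldType} {W : normedModType K} (E : set W) x :
  closure E x <-> forall e : K, 0 < e -> exists2 y, E y & `|x - y| < e.
Proof.
split=> [clEx e e0|clEx B].
  have [y [Ey xy]] := clEx _ (nbhsx_ballx x e e0).
  by exists y => //; rewrite -ball_normE in xy.
rewrite -nbhs_ballE => -[e /= e0 xeB]; have [y Ey xy] := clEx e e0.
by exists y; split=> //; apply: xeB; rewrite -ball_normE.
Qed.

Lemma near_sqr_dist (K : numFieldType) (W W' : normedModType K) (g : W -> W')
    y z (F : set_system W) {FF : Filter F} : continuous g -> F --> z ->
  forall e : K, 0 < e ->
    \forall z' \near F, `| `|y - g z| ^+ 2 - `|y - g z'| ^+ 2 | < e.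
Proof.
move=> cg Fz; apply/cvgrPdist_lt.
have cn : `|y - g z'| @[z' --> F] --> (`|y - g z| : K).
  apply: cvg_norm; apply: cvgB; first exact: cvg_cst.
  exact: continuous_cvg (cg z) Fz.
exact: (cvgM cn cn).
Qed.

(** Polarization: the norm determines only the sum of an inner product and its
    conjugate, which is twice its real part; scaling the second vector by ['i]
    gives the imaginary part as well. *)
Lemma eq_add_conj (C : numClosedFieldType) (c d : C) :
  c + c^* = d + d^* -> 'i^* * c + ('i^* * c)^* = 'i^* * d + ('i^* * d)^* ->
  c = d.
Proof.
rewrite !rmorphM /= conjCK conjCi !mulNr ![- _ + _]addrC -!mulrBr.
move=> cd /(mulfI (neq0Ci _)) cd'.
have : c *+ 2 = d *+ 2.
  have E (z : C) : z *+ 2 = (z + z^*) - (z^* - z) by rewrite mulr2n; ring.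
  by rewrite !E cd cd'.
by move/eqP; rewrite eqrMn2r// => /eqP.
Qed.

Section Isometry.
Context {R : realType} {H : completeNormedModType R[i]}.
Variable dot : {dot H for @conjC R[i]}.
Hypothesis normH : hilbert_norm dot.

Variable V : {linear H -> H}.
Hypothesis isoV : isometry_on setT V.

Lemma isometry_continuous : continuous V.
Proof.
move=> x; apply/cvgrPdist_lt => e e0; apply/nbhs_normP.
by exists e => //= x'; rewrite -linearB isoV.
Qed.

Lemma dot_isometry x y : dot (V x) (V y) = dot x y.
Proof.
have re z : dot (V x) (V z) + (dot (V x) (V z))^* = dot x z + (dot x z)^*.
  have := sqr_normB normH (V x) (V z); rewrite -linearB !isoV//.
  by rewrite (sqr_normB normH) => /addrI/oppr_inj.
apply: eq_add_conj (re y) _.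
by have := re ('i *: y); rewrite linearZ !dotZr.
Qed.

(** Riesz representation for the functionals [x |-> dot (V x) y], by least
    squares: the functional is represented by the point [z] at which
    [`|y - V z|] is minimal, since minimality makes [y - V z] orthogonal to the
    range of [V]. As [V] is isometric, the parallelogram identity shows that
    near-minimizers are close to each other, so that they form a Cauchy filter
    [F], whose limit is [z]. *)
Lemma isometry_adjoint_ex y : exists z, forall x, dot (V x) y = dot x z.
Proof.
pose f z := `|y - V z| ^+ 2.
have [|d [df fd]] := @complex_inf R H f 0; first by move=> z; rewrite exprn_ge0.
pose A (e : R[i]) := [set z | f z < d + e].
pose F := filter_from [set e : R[i] | 0 < e] A.
have FF : ProperFilter F.
  apply: filter_from_proper; last first.
    by move=> e e0; have [z fz] := fd e e0; exists z.
  apply: filter_from_filter; first by exists 1; rewrite /= ltr01.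
  move=> a b a0 b0; have /orP[ab|ba] : (a <= b) || (b <= a).
    by apply: real_leVge; apply: gtr0_real.
  - exists a => // z /= za; split=> //=; exact: lt_le_trans za (lerD _ _).
  - exists b => // z /= za; split=> //=; exact: lt_le_trans za (lerD _ _).
have cF : cauchy F.
  apply: cauchy_exP => e e0.
  have e20 : 0 < e ^+ 2 / 4 by rewrite divr_gt0// exprn_gt0.
  have [z fz] := fd _ e20; exists z; exists (e ^+ 2 / 4) => //= z' /= fz'.
  rewrite -ball_normE /= -(@ltr_pXn2r _ 2) ?nnegrE ?(ltW e0)//.
  rewrite -(isoV (x := z - z'))// linearB.
  rewrite -[V z - _](_ : (y - V z') - (y - V z) = _).
    rewrite (parallelogram normH) -/(f z) -/(f z').
    (* The midpoint of two near-minimizers is no better than the infimum. *)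
    pose w := 2^-1 *: (z + z').
    have -> : y - V z' + (y - V z) = 2 *: (y - V w).
      rewrite scalerBr -linearZ /w scalerA divff// scale1r linearD scaler_nat.
      by rewrite mulr2n opprD addrACA [- _ - _]addrC.
    rewrite normrZ exprMn -/(f w) ger0_norm//.
    have := df w; have : f z' < d + e ^+ 2 / 4 := fz'.
    move: (f z) (f z') (f w) fz => a b c.
    rewrite -subr_gt0.
    have -> : e ^+ 2 - (b *+ 2 + a *+ 2 - 2 ^+ 2 * c) =
        (d + e ^+ 2 / 4 - a) *+ 2 + (d + e ^+ 2 / 4 - b) *+ 2 + 4 * (c - d).
      by field.
    move=> az bz dc; rewrite ltr_wpDr ?mulr_ge0 ?subr_ge0//.
    by rewrite addr_gt0// pmulrn_lgt0// subr_gt0.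
  by rewrite opprB addrC addrA subrK.
have [z Fz] : exists z : H, F --> z by exists (lim F); exact/cauchy_cvgP.
have fzd : f z = d.
  have := df z; rewrite le_eqVlt => /orP[/eqP->//|ltd].
  have e0 : 0 < (f z - d) / 2 by rewrite divr_gt0// subr_gt0.
  have [|z' [/= z1 z2]] := @filter_ex _ F _
      ([set z' | `|f z - f z'| < (f z - d) / 2] `&` A ((f z - d) / 2)).
    apply: filterI; last by exists ((f z - d) / 2).
    exact: (near_sqr_dist y isometry_continuous Fz e0).
  have := ltrD z1 z2.
  have -> : (f z - d) / 2 + (d + (f z - d) / 2) = f z by field.
  move=> /(le_lt_trans _) => /(_ (f z)); rewrite ltxx => /(_ _)/negP; case=> //.
  rewrite -lerBlDr; apply: real_ler_norm; apply: realB; apply: ger0_real;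
    exact: exprn_ge0.
exists z => x; apply/eqP; rewrite -subr_eq0 -(dot_isometry x z) -linearBr/=.
apply/eqP/dot0C/(orth_of_le_dist normH) => a.
by rewrite -/(f z) fzd -addrA -opprD -linearZ -linearD; exact: df.
Qed.

End Isometry.

(** * Closed subspaces and Hilbert sums *)

Section Subspaces.
Context {R : realType} {H : completeNormedModType R[i]}.

Definition subspace (M : set H) : Prop :=
  M 0 /\ forall a x y, M x -> M y -> M (a *: x + y).

Lemma subspaceP (M : set H) : submod_closed [in M] <-> subspace M.
Proof.
split=> -[M0 MP]; split.
- by move: M0; rewrite inE.
- by move=> a x y Mx My; have := MP a x y; rewrite !inE; apply.
- by rewrite inE.
- by move=> a x y; rewrite !inE; apply: MP.
Qed.

Variable M : set H.
Hypothesis sM : subspace M.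

Lemma subspaceB x y : M x -> M y -> M (x - y).
Proof. by move=> Mx My; rewrite addrC -scaleN1r; apply: sM.2. Qed.

Lemma subspaceD x y : M x -> M y -> M (x + y).
Proof. by move=> Mx My; rewrite -[x]scale1r; apply: sM.2. Qed.

Lemma subspace_sum (I : eqType) (s : seq I) (f : I -> H) :
  (forall i, i \in s -> M (f i)) -> M (\sum_(i <- s) f i).
Proof.
move=> Mf; rewrite big_seq; elim/big_ind: _ => //; first exact: sM.1.
exact: subspaceD.
Qed.

Lemma subspace_closure : closed_subspace (closure M).
Proof.
split; first exact: closed_closure.
apply/subspaceP; split; first by apply: subset_closure; exact: sM.1.
move=> a x y /closure_normP clx /closure_normP cly; apply/closure_normP => e e0.
have a1 : 0 < `|a| + 1 by rewrite ltr_wpDl.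
have [x' Mx' xx'] := clx _ (divr_gt0 (divr_gt0 e0 (ltr0n _ 2)) a1).
have [y' My' yy'] := cly _ (divr_gt0 e0 (ltr0n _ 2)).
exists (a *: x' + y'); first exact: sM.2.
rewrite opprD addrACA -scalerBr (le_lt_trans (ler_normD _ _))//.
rewrite [e]splitr ltrD// normrZ; rewrite ltr_pdivlMr// in xx'.
by apply: le_lt_trans xx'; rewrite mulrC ler_wpM2l// lerDl.
Qed.

End Subspaces.

Lemma subspace_preim {R : realType} {H : completeNormedModType R[i]}
    (V : {linear H -> H}) (C : set H) :
  continuous V -> closed_subspace C -> closed_subspace [set x | C (V x)].
Proof.
move=> cV [clC /subspaceP [C0 CP]]; split.
  by have /continuous_closedP := cV; apply.
apply/subspaceP; split; first by rewrite /= linear0.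
by move=> a x y /= Cx Cy; rewrite linearP; apply: CP.
Qed.

Section HilbertSums.
Context {R : realType} {H : completeNormedModType R[i]}.
Variables (I : eqType) (E : I -> set H).

Lemma sub_hsum i : E i `<=` hsum E.
Proof.
move=> x Ex; apply: subset_closure; exists [:: i], (fun=> x); split=> //.
  by move=> j; rewrite inE => /eqP->.
by rewrite big_seq1.
Qed.

Lemma hsum_sub (M : set H) :
  closed_subspace M -> (forall i, E i `<=` M) -> hsum E `<=` M.
Proof.
move=> [clM /subspaceP sM] EM; rewrite (closure_id M).1//.
apply: closure_subset => _ [s [f [_ Ef ->]]].
by apply: subspace_sum => // i /Ef; apply: EM.
Qed.

Lemma hsum_closed_subspace :
  (forall i, subspace (E i)) -> closed_subspace (hsum E).
Proof.
move=> sE; apply: subspace_closure; split.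
  by exists [::], (fun=> 0); split=> //; rewrite big_nil.
move=> a _ _ [s [f [us Ef ->]]] [t [g [ut Eg ->]]].
pose f' i := if i \in s then f i else 0.
pose g' i := if i \in t then g i else 0.
exists (undup (s ++ t)), (fun i => a *: f' i + g' i); split.
- exact: undup_uniq.
- move=> i _; apply: (sE i).2.
    by rewrite /f'; case: ifP => [/Ef//|_]; exact: (sE i).1.
  by rewrite /g'; case: ifP => [/Eg//|_]; exact: (sE i).1.
rewrite big_split/= -scaler_sumr; congr (a *: _ + _).
- rewrite -big_mkcond -[RHS]big_filter; apply: perm_big; apply: uniq_perm => //.
    by rewrite filter_uniq// undup_uniq.
  by move=> i; rewrite mem_filter mem_undup mem_cat; case: (i \in s).
- rewrite -big_mkcond -[RHS]big_filter; apply: perm_big; apply: uniq_perm => //.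
    by rewrite filter_uniq// undup_uniq.
  by move=> i; rewrite mem_filter mem_undup mem_cat orbC; case: (i \in t).
Qed.

End HilbertSums.

(** * Adjoints and the Wold decomposition *)

Section Adjoint.
Context {R : realType} {H : completeNormedModType R[i]}.
Variable dot : {dot H for @conjC R[i]}.
Hypothesis normH : hilbert_norm dot.

Lemma eq_norm_of_dot x y : dot x x = dot y y -> `|x| = `|y|.
Proof.
by rewrite !normH => /eqP; rewrite eqrXn2// => /eqP.
Qed.

Lemma adjoint_on_eq (M : set H) (T : H -> H) y z : subspace M -> M z ->
  (forall x, M x -> dot (T x) y = dot x z) -> adjoint_on dot M T y = z.
Proof.
move=> sM Mz Tyz; rewrite /adjoint_on; case: xgetP => [w _ [Mw Tyw]|/(_ z)].
  apply/eqP; rewrite -subr_eq0 -normr_eq0 -sqrf_eq0 -normH.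
  have Mwz := subspaceB sM Mw Mz.
  by rewrite linearBr/= -Tyw// -Tyz// subrr.
by case; split.
Qed.

Lemma adjoint_eq (T : H -> H) y z :
  (forall x, dot (T x) y = dot x z) -> adjoint dot T y = z.
Proof. by move=> Tyz; apply: adjoint_on_eq. Qed.

Section Unitary.
Variable U : {linear H -> H}.
Hypothesis unU : unitary_on dot setT U.

(** If no vector represented the functional of [y], its adjoint would take the
    default value 0, and then [y = U 0 = 0], whose functional is represented
    by 0. *)
Lemma unitary_dot_adjoint x y : dot (U x) y = dot x (adjoint dot U y).
Proof.
have := (unU (x := y) I).2; rewrite /adjoint /adjoint_on.
case: xgetP => [w _ [_ ->]//|_]; rewrite linear0 => <-.
by rewrite !linear0r.
Qed.

Lemma unitaryK x : adjoint dot U (U x) = x /\ U (adjoint dot U x) = x.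
Proof. exact: unU. Qed.

Lemma unitary_norm x : `|U x| = `|x|.
Proof. by apply: eq_norm_of_dot; rewrite unitary_dot_adjoint (unitaryK x).1. Qed.

Lemma unitary_adjoint_norm x : `|adjoint dot U x| = `|x|.
Proof. by apply: eq_norm_of_dot; rewrite -unitary_dot_adjoint (unitaryK x).2. Qed.

Lemma unitary_adjointK x : adjoint dot (adjoint dot U) x = U x.
Proof.
by apply: adjoint_eq => y; rewrite dotC -unitary_dot_adjoint -dotC.
Qed.

End Unitary.

Section Isometry.
Variable V : {linear H -> H}.
Hypothesis isoV : isometry_on setT V.
Local Notation Vs := (adjoint dot V).

Lemma dot_adjoint x y : dot (V x) y = dot x (Vs y).
Proof.
have [z Vyz] := isometry_adjoint_ex normH isoV y.
by rewrite (adjoint_eq (z := z)).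
Qed.

Lemma adjoint_isoK x : Vs (V x) = x.
Proof. by apply: adjoint_eq => y; rewrite (dot_isometry normH isoV). Qed.

Lemma adjoint_linear a x y : Vs (a *: x + y) = a *: Vs x + Vs y.
Proof.
apply: adjoint_eq => z; rewrite !linearDr/= !dotZr; congr (_ * _ + _);
  exact: dot_adjoint.
Qed.

Lemma adjointB x y : Vs (x - y) = Vs x - Vs y.
Proof.
by rewrite addrC -scaleN1r adjoint_linear scaleN1r addrC.
Qed.

Lemma adjoint0 : Vs 0 = 0.
Proof. by have := adjointB 0 0; rewrite !subrr. Qed.

(** [V (Vs x)] is the orthogonal projection of [x] on the range of [V], and its
    norm is that of [Vs x]; a projection that keeps the norm of [x] fixes
    [x]. *)
Lemma norm_adjoint_range x : `|Vs x| = `|x| -> V (Vs x) = x.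
Proof.
move=> nx; apply/esym/eqP; rewrite -subr_eq0 -normr_eq0 -sqrf_eq0.
have e : dot (V (Vs x)) x = `|x| ^+ 2 by rewrite dot_adjoint normH nx.
rewrite (sqr_normB normH) isoV// nx dotC e conj_Creal ?realX ?normr_real//.
by rewrite conj_Creal ?realX ?normr_real// subrr.
Qed.

Lemma iter_linear m a x y :
  iter m V (a *: x + y) = a *: iter m V x + iter m V y.
Proof. by elim: m => //= m ->; rewrite linearP. Qed.

Lemma iterB m x y : iter m V (x - y) = iter m V x - iter m V y.
Proof. by rewrite addrC -scaleN1r iter_linear scaleN1r addrC. Qed.

Lemma norm_iter m x : `|iter m V x| = `|x|.
Proof. by elim: m => //= m <-; rewrite isoV. Qed.

Lemma dot_iter m x y : dot (iter m V x) y = dot x (iter m Vs y).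
Proof. by elim: m y => //= m IH y; rewrite dot_adjoint IH -iterSr. Qed.

Lemma adjoint_iterK m x : iter m Vs (iter m V x) = x.
Proof. by elim: m => //= m IH; rewrite -iterS iterSr /= adjoint_isoK. Qed.

Lemma dot_isometry_iter m x y : dot (iter m V x) (iter m V y) = dot x y.
Proof. by rewrite dot_iter adjoint_iterK. Qed.

Lemma iter_preim m (C : set H) :
  closed_subspace C -> closed_subspace [set x | C (iter m V x)].
Proof.
elim: m C => //= m IH C cC; apply: (IH [set x | C (V x)]).
exact: subspace_preim (isometry_continuous isoV) cC.
Qed.

(** The Wold decomposition of a shift, in the form of an induction principle:
    [x] differs from [iter m V (iter m Vs x)], which tends to 0, by the sum of
    the [iter k V w] for [k < m], where [w] is the component of [iter k Vs x]
    in the kernel of [Vs]. Quantifying over the closed subspaces [C] spares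
    infinite sums, and iterates well over several isometries. *)
Lemma wold (M C : set H) : subspace M -> closed_subspace C ->
    (forall x, M x -> M (V x)) -> (forall x, M x -> M (Vs x)) ->
    (forall x, M x -> iter m Vs x @[m --> \oo] --> (0 : H)) ->
    (forall m w, M w -> Vs w = 0 -> C (iter m V w)) ->
  M `<=` C.
Proof.
move=> sM [clC /subspaceP sC] MV MVs shiftM CW x Mx.
have iterM m : M (iter m Vs x) by elim: m => //= m; exact: MVs.
have Cm m : C (x - iter m V (iter m Vs x)).
  elim: m => [|m IH]; first by rewrite subrr; exact: sC.1.
  set u := iter m Vs x in IH *.
  rewrite -(subrKA (iter m V u)) iterSr -iterB.
  apply: subspaceD => //; apply: CW.
    by apply: subspaceB => //; [exact: iterM|exact/MV/MVs/iterM].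
  by rewrite adjointB adjoint_isoK subrr.
rewrite (closure_id C).1//; apply/closure_normP => e e0.
have /cvgrPdist_lt /(_ e e0) := shiftM x Mx; case=> m _ /(_ m (leqnn m))/= xm.
exists (x - iter m V (iter m Vs x)) => //.
by rewrite subKr norm_iter; rewrite sub0r normrN in xm.
Qed.

(** As [M] reduces [V], it contains [Vs x], which represents the functional of
    [x] on all of [H]; on [M] the representing vector is unique. *)
Lemma adjoint_on_reduces (M : set H) x :
  closed_subspace M -> reduces dot M V -> M x -> adjoint_on dot M V x = Vs x.
Proof.
move=> [_ /subspaceP sM] [_ MVs] Mx; apply: adjoint_on_eq => //.
  by apply: MVs; exists x.
by move=> y _; exact: dot_adjoint.
Qed.

Lemma iter_adjoint_on_reduces (M : set H) x m :
    closed_subspace M -> reduces dot M V -> M x ->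
  iter m (adjoint_on dot M V) x = iter m Vs x.
Proof.
move=> cM rM Mx; suff [] : iter m (adjoint_on dot M V) x = iter m Vs x /\
  M (iter m Vs x) by [].
elim: m => //= m [-> Mm]; rewrite adjoint_on_reduces//; split=> //.
by apply: rM.2; exists (iter m Vs x).
Qed.

End Isometry.
End Adjoint.

(** * Monomials *)

Section Words.
Context {R : realType} {H : completeNormedModType R[i]}.
Variables (n : nat) (V : 'I_n -> {linear H -> H}).

(** The monomials [Vpow] over arbitrary lists of indices and exponents, to allow
    induction on the list. *)
Definition word (p : seq ('I_n * nat)) : H -> H :=
  \big[comp/id]_(q <- p) iter q.2 (V q.1).

Lemma word_nil x : word [::] x = x.
Proof. by rewrite /word big_nil. Qed.

Lemma word_cons i m p x : word ((i, m) :: p) x = iter m (V i) (word p x).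
Proof. by rewrite /word big_cons. Qed.

Lemma Vpow_word (A : {set 'I_n}) (k : #|A|.-tuple nat) :
  Vpow V k = word (zip (enum A) k).
Proof.
rewrite /Vpow /word.
have es : size (enum A) == #|A| by rewrite cardE.
have enumE : enum A = [seq enum_val j | j <- enum 'I_#|A|].
  rewrite -[LHS](map_tnth_enum (Tuple es)); apply: eq_map => j.
  by rewrite (tnth_nth (enum_default j)).
rewrite enumE -(map_tnth_enum k) zip_map big_map enumT.
by rewrite [index_enum _]unlock.
Qed.

Lemma word_zero (s : seq 'I_n) m x : word (zip s (nseq m 0%N)) x = x.
Proof.
by elim: s m => [|i s IH] [|m] /=; rewrite ?word_nil// word_cons IH.
Qed.

(** Brings a single [V j] to the front of a monomial without commuting
    operators, so that the range of all monomials is seen to be contained in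
    that of each power of [V j]. *)
Lemma word_pulse (s : seq 'I_n) j m : uniq s -> j \in s ->
  word [seq (i, if i == j then m else 0%N) | i <- s] =1 iter m (V j).
Proof.
have out t x : j \notin t ->
    word [seq (i, if i == j then m else 0%N) | i <- t] x = x.
  elim: t => [|i t IH]; first by rewrite word_nil.
  rewrite inE negb_or => /andP[/negPf ij jt]; rewrite map_cons word_cons.
  by rewrite eq_sym ij IH.
elim: s => //= i s IH /andP[si us]; rewrite inE => /predU1P[ji|js] x.
  by rewrite word_cons -ji eqxx out// ji.
rewrite word_cons IH//; case: eqP => // ij.
by rewrite ij js in si.
Qed.

Lemma tuple_pulse (A : {set 'I_n}) j m : exists l : #|A|.-tuple nat,
  zip (enum A) l = [seq (i, if i == j then m else 0%N) | i <- enum A].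
Proof.
pose l := [seq if i == j then m else 0%N | i <- enum A].
have sl : size l == #|A| by rewrite size_map -cardE.
exists (Tuple sl) => /=; rewrite /l.
by elim: (enum A) => //= i s ->.
Qed.

End Words.

(** * Twisted isometries *)

Section Twisted.
Context {R : realType} {H : completeNormedModType R[i]}.
Variable dot : {dot H for @conjC R[i]}.
Hypothesis normH : hilbert_norm dot.
Variables (n : nat) (V : 'I_n -> {linear H -> H}).
Hypothesis isoV : forall i, isometry_on setT (V i).

(** What the twisted commutation relations are used for: it makes no reference
    to the unitaries, and it puts both [V j] and its adjoint in control of the
    kernel of the adjoint of [V i]. *)
Definition norm_twisted : Prop :=
  forall i j x, i != j -> `|adjoint dot (V i) (V j x)| = `|adjoint dot (V i) x|.

Lemma twisted_norm : twisted_isometry dot V -> norm_twisted.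
Proof.
move=> [U [unU _ _ twV _]] i j x ij; have /= -> := twV i j ij x.
have -> z : `|adjoint dot (U i j) z| = `|z|.
  case: (ltngtP i j) => [lt_ij|lt_ji|/ord_inj/eqP]; last by rewrite (negPf ij).
    exact: (unitary_adjoint_norm normH (unU i j lt_ij).1).
  have [un Uij] := unU j i lt_ji.
  have -> : adjoint dot (U i j) z = U j i z.
    rewrite -(unitary_adjointK normH un) /adjoint; congr adjoint_on.
    exact/funext.
  exact: unitary_norm.
exact: isoV.
Qed.

Hypothesis tw : norm_twisted.
Local Notation Vs i := (adjoint dot (V i)).

Lemma ker_adjoint_V i j x : i != j -> Vs i x = 0 -> Vs i (V j x) = 0.
Proof. by move=> ij x0; apply: normr0_eq0; rewrite tw// x0 normr0. Qed.

(** By [tw] the adjoint of [V i] keeps the norm of [V j (V i x)], which is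
    therefore in the range of [V i]. Thus [V j] preserves that range, and dually
    its adjoint preserves the kernel, as the next lemma says. *)
Lemma range_V i j x : i != j -> V i (Vs i (V j (V i x))) = V j (V i x).
Proof.
move=> ij; apply: (norm_adjoint_range normH (isoV i)).
by rewrite tw// (adjoint_isoK normH (isoV i)) !isoV.
Qed.

Lemma ker_adjoint_adjoint i j x : i != j -> Vs i x = 0 -> Vs i (Vs j x) = 0.
Proof.
move=> ij x0; apply: (dot_inj normH) => z.
rewrite -!dot_adjoint//; rewrite -range_V// dot_adjoint// x0.
by rewrite !linear0r.
Qed.

Lemma subspace_ker i : subspace [set x | Vs i x = 0].
Proof.
split=> [|a x y /= x0 y0]; first exact: adjoint0.
by rewrite adjoint_linear// x0 y0 scaler0 addr0.
Qed.

(** [wold] for the first index [i] reduces the claim to vectors [iter m (V i) w]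
    with [w] in the part of [M] that is killed by the adjoint of [V i]. This
    part is again stable under the other operators, and the induction
    hypothesis applies to it and to the preimage of [C] under
    [iter m (V i)]. *)
Lemma wold_word s (M C : set H) : uniq s -> subspace M -> closed_subspace C ->
    (forall i x, i \in s -> M x -> M (V i x) /\ M (Vs i x)) ->
    (forall i x, i \in s -> M x -> iter m (Vs i) x @[m --> \oo] --> (0 : H)) ->
    (forall k w, size k = size s -> M w -> (forall i, i \in s -> Vs i w = 0) ->
      C (word V (zip s k) w)) ->
  M `<=` C.
Proof.
elim: s M C => [|i s IH] M C us sM cC MV shM CM.
  by move=> x Mx; have := CM [::] x; rewrite /= word_nil; apply.
move: us => /= /andP[si us].
have ne j : j \in s -> i != j by move=> js; apply: contraNneq si => ->.
apply: (wold normH (isoV i) sM cC) => [x /(MV i)[]|x /(MV i)[]|x /shM|m w Mw w0].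
- by rewrite mem_head.
- by [].
- by rewrite mem_head.
- by [].
- by apply; rewrite mem_head.
have := IH [set x | M x /\ Vs i x = 0] [set x | C (iter m (V i) x)] us.
apply=> //.
- split; first by split; [exact: sM.1|exact: adjoint0].
  move=> a x y [Mx x0] [My y0]; split; first exact: sM.2.
  exact: (subspace_ker i).2.
- exact: iter_preim.
- move=> j x js [Mx x0]; have [|MVx MVsx] := MV j x _ Mx.
    by rewrite inE js orbT.
  split; split=> //; [apply: ker_adjoint_V|apply: ker_adjoint_adjoint] => //;
  exact: ne.
- by move=> j x js [Mx _]; apply: shM => //; rewrite inE js orbT.
move=> k u sk [Mu u0] us0 /=; rewrite -word_cons.
apply: (CM (m :: k)) => //=; first by rewrite sk.
by move=> j; rewrite inE => /predU1P[->//|]; exact: us0.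
Qed.

Lemma ker_adjoint_word s i k x : i \notin s -> Vs i x = 0 ->
  Vs i (word V (zip s k) x) = 0.
Proof.
elim: s k => [|j s IH] [|m k]; rewrite /= ?word_nil//.
rewrite inE negb_or => /andP[ij si] x0; rewrite word_cons.
by elim: m => [|m IHm] /=; [exact: IH|exact: ker_adjoint_V].
Qed.

(** At the first index [i] where the exponents differ, isometry cancels the
    common power. One side then starts with [V i], while the other one is in
    the kernel of its adjoint, because the remaining monomial involves other
    indices only. *)
Lemma orth_word s k k' x y : uniq s -> size k = size s -> size k' = size s ->
    k != k' -> (forall i, i \in s -> Vs i x = 0) ->
    (forall i, i \in s -> Vs i y = 0) ->
  dot (word V (zip s k) x) (word V (zip s k') y) = 0.
Proof.
elim: s k k' x y => [|i s IH] [|m k] [|m' k'] x y //= /andP[si us] [sk] [sk'].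
move=> kk' wx wy; rewrite !word_cons.
have ix : Vs i x = 0 by apply: wx; rewrite mem_head.
have iy : Vs i y = 0 by apply: wy; rewrite mem_head.
have step p u v : Vs i u = 0 -> dot u (iter p.+1 (V i) v) = 0.
  by move=> u0; apply: dot0C; rewrite /= dot_adjoint// u0 linear0r.
case: (ltngtP m m') => [lt_m|lt_m|e].
- rewrite -(subnKC (ltnW lt_m)) iterD dot_isometry_iter//.
  rewrite -(prednK (n := m' - m)) ?subn_gt0//; apply: step.
  exact: ker_adjoint_word.
- rewrite -(subnKC (ltnW lt_m)) iterD dot_isometry_iter//; apply: dot0C.
  rewrite -(prednK (n := m - m')) ?subn_gt0//; apply: step.
  exact: ker_adjoint_word.
rewrite e dot_isometry_iter//; apply: IH => //.
- by apply: contraNneq kk' => ->; rewrite e.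
- by move=> j js; apply: wx; rewrite inE js orbT.
- by move=> j js; apply: wy; rewrite inE js orbT.
Qed.

Lemma word_linear p a x y :
  word V p (a *: x + y) = a *: word V p x + word V p y.
Proof.
elim: p => [|[i m] p IH]; first by rewrite !word_nil.
by rewrite !word_cons IH iter_linear.
Qed.

Lemma word_stable p (M : set H) x :
  (forall i u, M u -> M (V i u)) -> M x -> M (word V p x).
Proof.
move=> MV Mx; elim: p => [|[i m] p IH]; first by rewrite word_nil.
by rewrite word_cons; elim: m => //= m; exact: MV.
Qed.

End Twisted.

(** * The core of a set of indices *)

Section Decomposition.
Context {R : realType} {H : completeNormedModType R[i]}.
Variable dot : {dot H for @conjC R[i]}.
Hypothesis normH : hilbert_norm dot.

(** A finite sum close to [x] splits as [g], in [S i], plus a vector of the other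
    summands. The latter is orthogonal to [x - g], so [g] alone is at least as
    close to [x]. *)
Lemma hsum_orth (I : eqType) (S : I -> set H) i x :
    (forall j, closed_subspace (S j)) -> orthogonal_family dot S ->
    hsum S x -> (forall j y, j != i -> S j y -> dot x y = 0) ->
  S i x.
Proof.
move=> cS oS /closure_normP Sx xo; rewrite (closure_id (S i)).1;
  last exact: (cS i).1.
apply/closure_normP => e e0; have [_ [s [f [us Sf ->]]] xs] := Sx e e0.
have [S0 SP] : subspace (S i) by apply/subspaceP; exact: (cS i).2.
(* The sum may have no term of index i. *)
pose g := if i \in s then f i else 0.
have Sg : S i g by rewrite /g; case: ifP => [/Sf|].
exists g => //; apply: le_lt_trans xs.
have -> : \sum_(j <- s) f j = g + \sum_(j <- s | j != i) f j.
  rewrite /g; case: ifPn => si; first by rewrite (bigD1_seq i).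
  rewrite add0r [in RHS]big_mkcond; apply: eq_big_seq => j js.
  by case: eqP si => // <-; rewrite js.
have o : dot (x - g) (- \sum_(j <- s | j != i) f j) = 0.
  rewrite linearNr/= linear_sumr big_seq_cond big1 ?oppr0// => j /andP[js ji].
  rewrite linearBl/= (xo j)//; last exact: Sf.
  by rewrite (oS i j)// ?subrr// 1?eq_sym//; exact: Sf.
by rewrite opprD addrA -ler_sqr ?nnegrE// (pythagoras normH o) lerDl exprn_ge0.
Qed.

Variables (n : nat) (V : 'I_n -> {linear H -> H}).
Hypothesis isoV : forall i, isometry_on setT (V i).
Local Notation Vs i := (adjoint dot (V i)).

Definition core (A : {set 'I_n}) : set H :=
  \bigcap_(l : #|~: A|.-tuple nat) (Vpow V l @` wandering dot V A).

Lemma core_range (A : {set 'I_n}) j m x : j \notin A -> core A x ->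
  exists2 y, wandering dot V A y & x = iter m (V j) y.
Proof.
move=> jA cx; have [l el] := tuple_pulse (~: A) j m.
have [y wy <-] := cx l I; exists y => //.
by rewrite Vpow_word el word_pulse ?enum_uniq// mem_enum inE.
Qed.

Lemma core_wandering (A : {set 'I_n}) : core A `<=` wandering dot V A.
Proof.
move=> x cx; have [y wy <-] := cx [tuple of nseq #|~: A| 0%N] I.
by rewrite Vpow_word word_zero.
Qed.

(** Some index is in one of the sets only. If it is an [i] of [A], then [y] is
    in the range of [V i], to which [x] is orthogonal, as [Vs i x = 0]. If it is
    a [j] of [B], then for all [m] there is a [z] of the norm of [x] with
    [x = iter m (V j) z], so that [dot x y = dot z (iter m (Vs j) y)], and this
    is as small as one likes. *)
Lemma core_orth (A B : {set 'I_n}) (M : set H) x y : A != B ->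
    (forall i z, M z -> M (Vs i z)) ->
    (forall j z, j \in B -> M z -> iter m (Vs j) z @[m --> \oo] --> (0 : H)) ->
    (forall j z, j \notin B -> M z -> V j (Vs j z) = z) ->
  core A x -> M y -> dot x y = 0.
Proof.
move=> AB MVs shB uniB cx My.
have [AsubB|/subsetPn[i iA iB]] := boolP (A \subset B); last first.
  apply: dot0C; rewrite -(uniB i y)// dot_adjoint//.
  by rewrite (core_wandering cx)// linear0r.
have /subsetPn[j jB jA] : ~~ (B \subset A).
  by apply: contra AB => BA; rewrite finset.eqEsubset AsubB.
apply/eqP/negPn/negP; rewrite -normr_gt0 => c0.
have x1 : 0 < `|x| + 1 by rewrite ltr_wpDl.
have /cvgrPdist_lt /(_ _ (divr_gt0 c0 x1)) := shB j y jB My.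
case=> m _ /(_ m (leqnn m))/=; rewrite sub0r normrN ltr_pdivlMr// => lt_xy.
have [z _ xz] := core_range m jA cx.
have : `|dot x y| <= `|iter m (Vs j) y| * (`|x| + 1).
  rewrite {1}xz dot_iter// (le_trans (cauchy_schwarz normH _ _))// mulrC.
  by rewrite ler_wpM2l// xz norm_iter// lerDl.
by move=> /le_lt_trans/(_ lt_xy); rewrite ltxx.
Qed.

Hypothesis tw : norm_twisted dot V.

(** Where [V j] is unitary its adjoint is its inverse, and it keeps the wandering
    vectors of [A] by [ker_adjoint_adjoint]; so the preimage of a wandering
    vector of [M] under a monomial can be computed with adjoints. *)
Lemma sub_core (A : {set 'I_n}) (M : set H) :
    (forall i z, M z -> M (Vs i z)) ->
    (forall j z, j \notin A -> M z -> V j (Vs j z) = z) ->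
  M `&` wandering dot V A `<=` core A.
Proof.
move=> MVs uniA x Mwx l _; rewrite Vpow_word.
have : forall j, j \in enum (~: A) -> j \notin A.
  by move=> j; rewrite mem_enum inE.
move: (enum (~: A)) (tval l) x Mwx => {l}.
suff word_onto s k x : (forall j, j \in s -> j \notin A) ->
    (M `&` wandering dot V A) x ->
  exists2 y, (M `&` wandering dot V A) y & word V (zip s k) y = x.
  move=> s k x Mwx sA; have [y [_ wy] <-] := word_onto s k x sA Mwx.
  by exists y.
elim: s k x => [|j s IH] [|m k] x sA Mwx /=; try by exists x; rewrite ?word_nil.
have jA : j \notin A by apply: sA; rewrite mem_head.
have [z Mwz <-] : exists2 z, (M `&` wandering dot V A) z & iter m (V j) z = x.
  elim: m x Mwx => [|m IHm] x [Mx wx]; first by exists x.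
  have [|z Mwz zx] := IHm (Vs j x).
    split=> [|i iA]; first exact: MVs.
    apply: ker_adjoint_adjoint => //; last exact: wx.
    by apply: contraNneq jA => <-.
  by exists z => //=; rewrite zx uniA.
have [|y Mwy <-] := IH k z _ Mwz.
  by move=> i si; apply: sA; rewrite inE si orbT.
by exists y => //; rewrite word_cons.
Qed.

End Decomposition.

(** * Uniqueness of the decomposition *)

Theorem corollary3p8 (R : realType) (H : completeNormedModType R[i])
    (dot : {dot H for @conjC R[i]}) (normH : hilbert_norm dot)
    (sepH : separable H)
    (n : nat) (n2 : (2 <= n)%N) (V : 'I_n -> {linear H -> H})
    (twV : twisted_isometry dot V)
    (S : {set 'I_n} -> set H)
    (closedS : forall A, closed_subspace (S A))
    (reducesS : forall A i, reduces dot (S A) (V i))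
    (orthoS : orthogonal_family dot S)
    (sumS : hsum S = setT)
    (shiftS : forall (A : {set 'I_n}) (i : 'I_n), i \in A ->
        shift_on dot (S A) (V i))
    (unitaryS : forall (A : {set 'I_n}) (j : 'I_n), j \in ~: A ->
        unitary_on dot (S A) (V j)) :
  forall A : {set 'I_n},
    orthogonal_family dot (@summand _ _ dot n V A) /\ S A = calH dot V A.
Proof.
have isoV i : isometry_on setT (V i) by have [U []] := twV.
have {}twV : norm_twisted dot V by exact: twisted_norm.
have sS A : subspace (S A) by apply/subspaceP; exact: (closedS A).2.
have SV A i x : S A x -> S A (V i x).
  by move=> Sx; apply: (reducesS A i).1; exists x.
have SVs A i x : S A x -> S A (adjoint dot (V i) x).
  by move=> Sx; apply: (reducesS A i).2; exists x.
have shS (A : {set 'I_n}) i x : i \in A -> S A x ->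
    iter m (adjoint dot (V i)) x @[m --> \oo] --> (0 : H).
  move=> iA Sx; have := (shiftS A i iA).2 x Sx.
  by under eq_fun do rewrite iter_adjoint_on_reduces//.
have unS (A : {set 'I_n}) j x : j \notin A -> S A x ->
    V j (adjoint dot (V j) x) = x.
  move=> jA Sx; rewrite -(adjoint_on_reduces normH (isoV j) (closedS A))//.
  by apply: (unitaryS A j _ x Sx).2; rewrite inE.
move=> A.
have coreE : core dot V A = S A `&` wandering dot V A.
  apply/seteqP; split=> x; last first.
    by apply: sub_core => //; [exact: SVs|exact: unS].
  move=> cx; split; last exact: core_wandering.
  apply: (hsum_orth normH closedS orthoS); first by rewrite sumS.
  by move=> B y BA Sy; apply: (@core_orth _ _ dot normH n V isoV A B (S B)) => //;
    by [rewrite eq_sym|exact: SVs|exact: shS|exact: unS].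
have summandE (k : #|A|.-tuple nat) :
    summand dot V k = word V (zip (enum A) k) @` core dot V A.
  by rewrite /summand Vpow_word.
have subspace_summand k : subspace (@summand _ _ dot n V A k).
  rewrite summandE coreE; split.
    exists 0; first split; [exact: (sS A).1|by move=> i _; exact: adjoint0|].
    have := @word_linear _ _ _ V (zip (enum A) k) (-1) 0 0.
    by rewrite scaleN1r addNr => ->; rewrite scaleN1r addNr.
  move=> a _ _ [x [Sx wx] <-] [y [Sy wy] <-].
  exists (a *: x + y); last exact: word_linear.
  split; first exact: (sS A).2.
  by move=> i iA; rewrite adjoint_linear// wx// wy// scaler0 addr0.
split.
  move=> k k' kk' u v; rewrite !summandE => -[x cx <-] [y cy <-].
  apply: orth_word; rewrite ?enum_uniq ?size_tuple -?cardE//.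
  - by move=> i; rewrite mem_enum; exact: core_wandering.
  - by move=> i; rewrite mem_enum; exact: core_wandering.
apply/seteqP; split.
  apply: (@wold_word _ _ _ normH _ _ isoV twV (enum A)).
  - exact: enum_uniq.
  - exact: sS.
  - exact: hsum_closed_subspace.
  - by move=> i x _ Sx; split; [exact: SV|exact: SVs].
  - by move=> i x; rewrite mem_enum; exact: shS.
  move=> k w sk Sw w0; have ck : size k == #|A| by rewrite sk -cardE.
  apply: (sub_hsum (i := Tuple ck)); rewrite summandE; exists w => //.
  rewrite coreE; split=> // i iA; apply: w0; by rewrite mem_enum.
apply: hsum_sub => // k; rewrite summandE coreE => _ [x [Sx _] <-].
by apply: word_stable => // i u; exact: SV.
Qed.
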